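(* Consider the interval exchange transformation $E_2^*$ of $[0,1)$, with $K=\mathbb{Q}(\rho)$ and $\mathcal{M}=\mathbb{Z}[\rho]$. The following hold. (i) Let $x$ be a point of the unit interval $[0,1)$ and let $\mu(x)$ be its Vershik code. Then $x\in\mathbb{Q}(\rho)\cap[0,1)$ if and only if $\mu(x)$ is eventually periodic. (ii) The restriction $\mathcal{M}\cap[0,1)$ of the module $\mathcal{M}$ to the unit interval consists of the (forward and backward) orbits of the discontinuity points of $E_2^*$. (iii) The map $E_2^*$ has the finite decomposition property. Specifically, there is a positive integer $M$ such that for each $\xi\in K$ the restriction $(\xi+\mathcal{M})\cap[0,1)$ of the layer $\xi+\mathcal{M}$ to the unit interval decomposes into at most $M$ orbits of $E_2^*$.
   Context: Definition of $E_2^*$: let $\rho\approx0.106711$ be the real root of $x^3-6x^2+10x-1$. Partition $[0,1)$ into seven consecutive half-open intervals $\Omega_1,\dots,\Omega_7$ (from left to right, closed on the left) with lengths $$(|\Omega_i|)=(1-5\rho+2\rho^2,\ -1+10\rho-3\rho^2,\ 1-9\rho+3\rho^2,\ \rho-\rho^2,\ -1+11\rho-4\rho^2,\ 1-9\rho+3\rho^2,\ \rho).$$ $E=E_2^*$ rearranges these intervals by translation according to the permutation $(5462731)$, i.e. the images of $\Omega_1,\dots,\Omega_7$ occupy positions $5,4,6,2,7,3,1$ respectively, counted from the left. Equivalently $E(x)=x+\tau_i$ on $\Omega_i$ with $$(\tau_i)=(3\rho-\rho^2,\ -2\rho,\ 1-7\rho+2\rho^2,\ -1+5\rho-2\rho^2,\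 1-8\rho+3\rho^2,\ -6\rho+2\rho^2,\ -1+\rho).$$ The discontinuity points are the left endpoints of $\Omega_2,\dots,\Omega_7$. The orbit of $x$ is $\{E^k(x):k\in\mathbb{Z}\}$. $\mathbb{Z}[\rho]$ is the $\mathbb{Z}$-module generated by $1,\rho,\rho^2$. Self-similarity: let $r(x)=1-\rho+\rho x$, which maps $[0,1)$ onto $\Omega_7=[1-\rho,1)$. The first-return map of $E$ on $\Omega_7$ is $r\circ E\circ r^{-1}$, and the points of $r(\Omega_i)$ visit, from time $0$ until just before their first return to $\Omega_7$, the intervals whose indices are the successive letters of $\sigma(i)$, where $\sigma(1)=7114115$, $\sigma(2)=7114121361361214115$, $\sigma(3)=711412136136135$, $\sigma(4)=71141214115$, $\sigma(5)=71156136135$, $\sigma(6)=711561361361214115$, $\sigma(7)=7115$. Vershik code: $\mathcal{P}$ is the set of pairs ($i$, proper prefix $\mu$ of $\sigma(i)$), the empty prefix included; for such a $\mu$ put $\chi(\mu)=i$, and let $|\mu|$ be its length. $[0,1)$ is the disjoint union of the sets $E^{|\mu|}(r(\Omega_{\chi(\mu)}))$, $\mu\in\mathcal{P}$. Hence for each $x\in[0,1)$ there are a unique $\mu_1\in\mathcal{P}$ and a unique $x'\in\Omega_{\chi(\mu_1)}$ with $x=E^{|\mu_1|}(r(x'))$; repeating with $x'$ in place of $x$, and so on, defines the Vershik code $\mu(x)=(\mu_1,\mu_2,\dots)\in\mathcal{P}^{\mathbb{N}}$. *)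

(* Defs.v *)
(* Letters and interval indices are the naturals 1, ..., 7. *)
From mathcomp Require Import all_boot all_order all_algebra.
From mathcomp Require Import all_classical all_reals.
From mathcomp Require Import ring.

Set Implicit Arguments.
Unset Strict Implicit.
Unset Printing Implicit Defensive.

Import Order.TTheory GRing.Theory Num.Theory.
Local Open Scope classical_set_scope.
Local Open Scope ring_scope.

Section Exchange.
Variables (R : realType) (rho : R).

(* The values outside 1..7 are junk: empty intervals, no translation. *)
Definition len (i : nat) : R :=
  match i with
  | 1%N => 1 - 5 * rho + 2 * rho ^+ 2
  | 2%N => - 1 + 10 * rho - 3 * rho ^+ 2
  | 3%N => 1 - 9 * rho + 3 * rho ^+ 2
  | 4%N => rho - rho ^+ 2
  | 5%N => - 1 + 11 * rho - 4 * rho ^+ 2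
  | 6%N => 1 - 9 * rho + 3 * rho ^+ 2
  | 7%N => rho
  | _ => 0
  end.

Definition left_end (i : nat) : R := \sum_(1 <= j < i) len j.

Definition Omega (i : nat) : interval R :=
  `[left_end i, left_end i + len i[.

Definition tau (i : nat) : R :=
  match i with
  | 1%N => 3 * rho - rho ^+ 2
  | 2%N => - 2 * rho
  | 3%N => 1 - 7 * rho + 2 * rho ^+ 2
  | 4%N => - 1 + 5 * rho - 2 * rho ^+ 2
  | 5%N => 1 - 8 * rho + 3 * rho ^+ 2
  | 6%N => - 6 * rho + 2 * rho ^+ 2
  | 7%N => - 1 + rho
  | _ => 0
  end.

(* The intervals are disjoint, so the sum has the single term [tau i] for x in
   [Omega i]; it is empty, and E2star x = x, outside [0, 1). *)
Definition E2star (x : R) : R :=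
  x + \sum_(1 <= i < 8 | x \in Omega i) tau i.

Definition unit_ivl : set R := [set` `[0, 1[].

(* E2star is bijective on [0, 1), so [iter k E2star y = x] with y in [0, 1)
   means that y is the image of x under the k-th iterate of its inverse. *)
Definition E2orbit (x : R) : set R :=
  [set y | unit_ivl y /\
           exists k, iter k E2star x = y \/ iter k E2star y = x].

Definition Zrho : set R :=
  [set x | exists a b c : int, x = a%:~R + b%:~R * rho + c%:~R * rho ^+ 2].

(* Q(rho), as the smallest subfield of R containing rho. *)
Definition Qrho : set R :=
  [set x | forall S : {pred R}, divring_closed S -> rho \in S -> x \in S].

Definition rscale (x : R) : R := 1 - rho + rho * x.

Definition sigma (i : nat) : seq nat :=
  match i with
  | 1%N => [:: 7; 1; 1; 4; 1; 1; 5]%N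
  | 2%N => [:: 7; 1; 1; 4; 1; 2; 1; 3; 6; 1; 3; 6; 1; 2; 1; 4; 1; 1; 5]%N
  | 3%N => [:: 7; 1; 1; 4; 1; 2; 1; 3; 6; 1; 3; 6; 1; 3; 5]%N
  | 4%N => [:: 7; 1; 1; 4; 1; 2; 1; 4; 1; 1; 5]%N
  | 5%N => [:: 7; 1; 1; 5; 6; 1; 3; 6; 1; 3; 5]%N
  | 6%N => [:: 7; 1; 1; 5; 6; 1; 3; 6; 1; 3; 6; 1; 2; 1; 4; 1; 1; 5]%N
  | 7%N => [:: 7; 1; 1; 5]%N
  | _ => [::]
  end.

(* Pairs (i, mu) with mu a proper prefix of [sigma i]; as [sigma i] is empty
   for i outside 1..7, no such i occurs. *)
Definition prefixes : set (nat * seq nat) :=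
  [set p | prefix p.2 (sigma p.1) && (size p.2 < size (sigma p.1))%N].

(* [desubst x (mu, x')] : x' lies in [Omega (chi mu)] and
   x = E2star^|mu| (rscale x'). *)
Definition desubst (x : R) (q : (nat * seq nat) * R) : Prop :=
  [/\ prefixes q.1, q.2 \in Omega q.1.1 &
      x = iter (size q.1.2) E2star (rscale q.2)].

(* For x in [0, 1) there is exactly one q with [desubst x q], and [xget] picks
   it; the first argument of [xget] is the junk value for other x. *)
Definition vershik_step (x : R) : (nat * seq nat) * R :=
  xget ((0%N, [::]), 0) [set q | desubst x q].

(* Indexed from 0: [vershik_code x n] is mu_(n+1). *)
Definition vershik_code (x : R) (n : nat) : nat * seq nat :=
  (vershik_step (iter n (fun y => (vershik_step y).2) x)).1.

End Exchange.

Arguments unit_ivl : clear implicits.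

Definition eventually_periodic (T : Type) (u : nat -> T) : Prop :=
  exists N p : nat, (0 < p)%N /\ forall n, (N <= n)%N -> u (n + p)%N = u n.

(* Position, counted from the left, of the image of the i-th interval. *)
Definition image_pos (i : nat) : nat := nth 0%N [:: 5; 4; 6; 2; 7; 3; 1]%N i.-1.

Lemma left_end_total (R : realType) (rho : R) : left_end rho 8 = 1.
Proof. by rewrite /left_end unlock /=; ring. Qed.

Lemma tau_image_pos (R : realType) (rho : R) (i : nat) : (1 <= i <= 7)%N ->
  tau rho i =
  \sum_(1 <= j < 8 | (image_pos j < image_pos i)%N) len rho j - left_end rho i.
Proof.
case: i => [//|[|[|[|[|[|[|[|//]]]]]]]] _;
  by rewrite /left_end unlock /=; ring.
Qed.

(* Main.v *)
(* The polynomial has one real root rho, which is a unit, and a pair of complex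
   roots of modulus about 3.  The desubstitution x = rho x' + c, with c in a
   finite subset of Z[rho], expands real differences by 1 / rho, but contracts
   the complex conjugates, the square of whose modulus is multiplied by rho.

   (i) Points of Q(rho) keep a bounded denominator under x |-> x', so their
   itineraries under this map stay in a finite set of algebraic numbers bounded
   in both embeddings.  Conversely, points with equal codes are equal, so an
   eventually periodic code gives an affine equation for x over Q(rho).
   (ii) Every point of Z[rho] is eventually mapped into an explicit set of 89
   points; each of them lies on the orbit of a discontinuity, a property that
   passes from x' to x since the scaling [rscale] maps orbits into orbits.
   (iii) Two points of a layer differ by an element of Z[rho]; after sufficiently
   many desubstitutions the difference lies in a finite set which does not
   depend on the layer, and inequivalent points remain distinct. *)
From HB Require Import structures.
Require Import Defs.
From Stdlib Require Import ZArith.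
From mathcomp Require Import all_boot all_order all_algebra.
From mathcomp Require Import all_classical all_reals.
From mathcomp Require Import zify ssrZ ring lra.

Set Implicit Arguments.
Unset Strict Implicit.
Unset Printing Implicit Defensive.

Import Order.TTheory GRing.Theory Num.Theory.

(** * Computation in Z[rho] *)

Section Triples.
Local Open Scope Z_scope.

Definition Z3 : Type := (Z * Z * Z)%type.

Definition const3 (k : Z) : Z3 := (k, 0, 0).

Definition add3 (s t : Z3) : Z3 :=
  let: (a, b, c) := s in let: (d, e, f) := t in (a + d, b + e, c + f).

Definition scale3 (k : Z) (t : Z3) : Z3 :=
  let: (a, b, c) := t in (k * a, k * b, k * c).

Definition sub3 (s t : Z3) : Z3 := add3 s (scale3 (-1) t).

Definition mul_rho (t : Z3) : Z3 :=
  let: (a, b, c) := t in (c, a - 10 * c, b + 6 * c).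

(** Uses 1 / rho = rho^2 - 6 rho + 10, read off the cubic equation. *)
Definition div_rho (t : Z3) : Z3 :=
  let: (a, b, c) := t in (10 * a + b, c - 6 * a, a).

Definition sum3 (s : seq Z3) : Z3 := foldr add3 (const3 0) s.

Definition len3 (i : nat) : Z3 :=
  match i with
  | 1%nat => (1, -5, 2)
  | 2%nat => (-1, 10, -3)
  | 3%nat => (1, -9, 3)
  | 4%nat => (0, 1, -1)
  | 5%nat => (-1, 11, -4)
  | 6%nat => (1, -9, 3)
  | 7%nat => (0, 1, 0)
  | _ => (0, 0, 0)
  end.

Definition tau3 (i : nat) : Z3 :=
  match i with
  | 1%nat => (0, 3, -1)
  | 2%nat => (0, -2, 0)
  | 3%nat => (1, -7, 2)
  | 4%nat => (-1, 5, -2)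
  | 5%nat => (1, -8, 3)
  | 6%nat => (0, -6, 2)
  | 7%nat => (-1, 1, 0)
  | _ => (0, 0, 0)
  end.

Definition left3 (i : nat) : Z3 := sum3 [seq len3 j | j <- index_iota 1 i].

Definition rscale3 (t : Z3) : Z3 := add3 (1, -1, 0) (mul_rho t).

(* The translation part of [x' |-> E2star^n (rscale x')] on [Omega i]. *)
Definition offset (p : nat * nat) : Z3 :=
  add3 (1, -1, 0) (sum3 [seq tau3 j | j <- take p.2 (sigma p.1)]).

Definition million_rho_lo : Z := 106710.
Definition million_rho_hi : Z := 106711.

(* A lower bound of 10^12 * (a + b rho + c rho^2), using
   0.106710 <= rho <= 0.106711. *)
Definition lower_bound (t : Z3) : Z :=
  let: (a, b, c) := t in
  a * (1000000 * 1000000)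
  + b * ((if 0 <=? b then million_rho_lo else million_rho_hi) * 1000000)
  + c * (if 0 <=? c then million_rho_lo * million_rho_lo
         else million_rho_hi * million_rho_hi).

(** These sign tests are sound only when they answer [true]; a [false] may just mean that the
    enclosure of rho is too coarse. *)
Definition nonneg3 (t : Z3) : bool := 0 <=? lower_bound t.
Definition pos3 (t : Z3) : bool := 0 <? lower_bound t.

(* If beta is a complex conjugate of rho, then
   |a + b beta + c beta^2|^2 is the number a' + b' rho + c' rho^2 given by
   this triple: beta + conj beta = 6 - rho and |beta|^2 = rho^2 - 6 rho + 10. *)
Definition conj_sqr (t : Z3) : Z3 :=
  let: (a, b, c) := t in
  (a * a + 10 * b * b + 94 * c * c + 6 * a * b + 16 * a * c + 59 * b * c,
   - 6 * b * b - 59 * c * c - a * b - 36 * b * c,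
   b * b + 10 * c * c - a * c + 6 * b * c).

(** The norm from Q(rho) to Q, expanded as a cubic form in the coordinates. *)
Definition norm3 (t : Z3) : Z :=
  let: (a, b, c) := t in
  a * a * a + b * b * b + c * c * c + 6 * a * a * b + 16 * a * a * c
  + 10 * a * b * b + 88 * a * c * c + 6 * b * b * c + 10 * b * c * c
  + 57 * a * b * c.

Definition in3 (s t u : Z3) : bool := nonneg3 (sub3 t s) && pos3 (sub3 u t).

(** The interval from [s] to [t] is pushed along [w]; at each letter it must lie in a single
    interval of the partition, so it moves without being cut. *)
Fixpoint itinerary3 (s t : Z3) (w : seq nat) : bool :=
  if w is j :: w' then
    [&& (0 < j < 8)%N, nonneg3 (sub3 s (left3 j)), nonneg3 (sub3 (left3 j.+1) t)
      & itinerary3 (add3 s (tau3 j)) (add3 t (tau3 j)) w']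
  else true.

(** The set of proper prefixes: a prefix of [sigma i] is encoded by its length. *)
Definition pieces : seq (nat * nat) :=
  [seq (i, n) | i <- iota 1 7, n <- iota 0 (size (sigma i))].

Definition piece_left (p : nat * nat) : Z3 :=
  add3 (offset p) (mul_rho (left3 p.1)).

Definition piece_right (p : nat * nat) : Z3 :=
  add3 (offset p) (mul_rho (left3 p.1.+1)).

(** Walks from [t] to 1, each piece starting exactly where the previous one ends; [n] bounds the
    number of pieces. *)
Fixpoint covers (s : seq (nat * nat)) (n : nat) (t : Z3) : bool :=
  if t == const3 1 then true else
  if n is n'.+1 then
    if [seq p <- s | piece_left p == t] is p :: _
    then covers s n' (piece_right p) else false
  else false.

Definition disjoint_images (i j : nat) : bool :=
  nonneg3 (sub3 (add3 (left3 i) (tau3 i)) (add3 (left3 j.+1) (tau3 j)))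
  || nonneg3 (sub3 (add3 (left3 j) (tau3 j)) (add3 (left3 i.+1) (tau3 i))).

(* The junk case [step3 t = t], for t outside [0, 1), is harmless since only
   the orbit relation between t and [step3 t] is used. *)
Definition step3 (t : Z3) : Z3 :=
  let i := (find (fun i => pos3 (sub3 (left3 i.+1) t)) (iota 1 7)).+1 in
  if in3 (left3 i) t (left3 i.+1) then add3 t (tau3 i) else t.

Definition discontinuities : seq Z3 := [seq left3 i | i <- iota 2 6].

Definition forward_orbits (n : nat) : seq Z3 :=
  flatten [seq traject step3 d n | d <- discontinuities].

Fixpoint reaches_discontinuity (n : nat) (t : Z3) : bool :=
  if t \in discontinuities then true else
  if n is n'.+1 then reaches_discontinuity n' (step3 t) else false.

(** Searches both directions of an orbit by forward steps only: either a discontinuity leads to [t],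
    or [t] leads to a discontinuity. *)
Definition connected3 (orbits : seq Z3) (n : nat) (t : Z3) : bool :=
  if t \in orbits then true else reaches_discontinuity n t.

Definition centered (n : nat) : seq Z :=
  [seq Z.of_nat k - Z.of_nat n | k <- iota 0 n.*2.+1].

(* 212 = 1 + 211, where 2 rho (211 + 776) <= 211 and 776 bounds [conj_sqr] of the
   offsets. *)
Definition small3 (t : Z3) : bool :=
  if pos3 (sub3 (const3 0) t) then false else
  if nonneg3 (sub3 t (const3 1)) then false else
  ~~ pos3 (sub3 (conj_sqr t) (const3 212)).

(** The enumerated coordinate is b + 6 c, which is near the bounded form [conj_im]; enumerating b
    itself would take a much larger box. *)
Definition small_triples : seq Z3 :=
  [seq t <- [seq (a, p.1 - 6 * p.2, p.2) | a <- centered 7,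
               p <- [seq (b, c) | b <- centered 18, c <- centered 7]] | small3 t].

(** * Finite verifications for the exchange and its substitution *)

Lemma all_len_pos : all (fun i => pos3 (len3 i)) (iota 1 7).
Proof. by vm_compute. Qed.

Lemma all_disjoint_images :
  all (fun i => all (fun j => (i == j) || disjoint_images i j) (iota 1 7)) (iota 1 7).
Proof. by vm_compute. Qed.

Lemma all_images_unit :
  all (fun i => nonneg3 (add3 (left3 i) (tau3 i))
                && nonneg3 (sub3 (const3 1) (add3 (left3 i.+1) (tau3 i)))) (iota 1 7).
Proof. by vm_compute. Qed.

Lemma all_itineraries :
  all (fun i => itinerary3 (rscale3 (left3 i)) (rscale3 (left3 i.+1)) (sigma i))
      (iota 1 7).
Proof. by vm_compute. Qed.

(** Self-similarity on the level of translations: a full passage along [sigma i] acts on the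
    rescaled interval as the rescaled [tau3 i]. *)
Lemma all_returns :
  all (fun i => sum3 [seq tau3 j | j <- sigma i] == mul_rho (tau3 i)) (iota 1 7).
Proof. by vm_compute. Qed.

Lemma covers_unit : covers pieces 85 (const3 0).
Proof. by vm_compute. Qed.

Lemma all_offsets_bounded :
  all (fun p => nonneg3 (sub3 (const3 776) (conj_sqr (offset p)))) pieces.
Proof. by vm_compute. Qed.

Lemma all_rscale_connected :
  all (fun d => connected3 (forward_orbits 30) 30 (rscale3 d)) discontinuities.
Proof. by vm_compute. Qed.

Lemma all_small_connected :
  all (connected3 (forward_orbits 30) 30) small_triples.
Proof. by vm_compute. Qed.

(* Infinite descent: the cubic form has no nontrivial zero modulo 5. *)
Lemma cubic_form_eq0 (k c : Z) :
  k * k * k - 6 * k * k * c + 10 * k * c * c - c * c * c = 0 -> c = 0.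
Proof.
have [n] := ubnP (Z.abs_nat c); elim: n k c => // n IHn k c cn E.
have := Z.div_mod k 5 ltac:(lia); have := Z.mod_pos_bound k 5 ltac:(lia).
have := Z.div_mod c 5 ltac:(lia); have := Z.mod_pos_bound c 5 ltac:(lia).
move: (k / 5) (c / 5) (k mod 5) (c mod 5) => k' c' i j j5 cE i5 kE.
have hi : i = 0 \/ i = 1 \/ i = 2 \/ i = 3 \/ i = 4 by lia.
have hj : j = 0 \/ j = 1 \/ j = 2 \/ j = 3 \/ j = 4 by lia.
subst k c; clear i5 j5.
case: hi => [|[|[|[|]]]] ?; case: hj => [|[|[|[|]]]] ?; subst i j;
  try (exfalso; clear IHn cn; lia).
(* Only the residues (0, 0) survive; dividing by 5^3 gives the same equation for k' and c', with c'
   smaller than c in absolute value. *)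
case: (Z.eq_dec c' 0) => [->|c0]; first by [].
suff: c' = 0 by lia.
by apply: (IHn k'); lia.
Qed.

End Triples.

Local Open Scope classical_set_scope.
Local Open Scope ring_scope.

(* Locked because unification would otherwise expand large literals in unary. *)
HB.lock Definition ZtoR (R : realType) (z : Z) : R := (int_of_Z z)%:~R.

(** * Real and complex embeddings of Z[rho] *)

Section Evaluation.
Variables (R : realType) (rho : R).
Hypothesis rho_root : rho ^+ 3 - 6 * rho ^+ 2 + 10 * rho - 1 = 0.

Local Notation ZtoR := (@ZtoR R).

Lemma ZtoRD x y : ZtoR (Z.add x y) = ZtoR x + ZtoR y.
Proof. by rewrite unlock -intrD; congr (_%:~R); lia. Qed.

Lemma ZtoRN x : ZtoR (Z.opp x) = - ZtoR x.
Proof. by rewrite unlock -intrN; congr (_%:~R); lia. Qed.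

Lemma ZtoRB x y : ZtoR (Z.sub x y) = ZtoR x - ZtoR y.
Proof. by rewrite ZtoRD ZtoRN. Qed.

Lemma ZtoRM x y : ZtoR (Z.mul x y) = ZtoR x * ZtoR y.
Proof. by rewrite unlock -intrM; congr (_%:~R); lia. Qed.

Lemma ZtoR_le x y : (ZtoR x <= ZtoR y) = Z.leb x y.
Proof. by rewrite unlock ler_int; lia. Qed.

Lemma ZtoR_lt x y : (ZtoR x < ZtoR y) = Z.ltb x y.
Proof. by rewrite unlock ltr_int; lia. Qed.

Lemma ZtoR0 : ZtoR 0 = 0. Proof. by rewrite unlock. Qed.

Lemma ZtoR1 : ZtoR 1 = 1. Proof. by rewrite unlock. Qed.

Lemma ZtoR_double p : ZtoR (Zpos p~0) = 2 * ZtoR (Zpos p).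
Proof. by rewrite [LHS](ZtoRM 2 (Zpos p)) [X in X * _](ZtoRD 1 1) ZtoR1. Qed.

Lemma ZtoR_double1 p : ZtoR (Zpos p~1) = 2 * ZtoR (Zpos p) + 1.
Proof. by rewrite [LHS](ZtoRD (Zpos p~0) 1) ZtoR_double ZtoR1. Qed.

Lemma ZtoR_neg p : ZtoR (Zneg p) = - ZtoR (Zpos p).
Proof. exact: (ZtoRN (Zpos p)). Qed.

Definition ZtoRE := (ZtoRD, ZtoRB, ZtoRN, ZtoRM, ZtoR0, ZtoR1,
  ZtoR_double, ZtoR_double1, ZtoR_neg).

(** If p is the cubic, p(a) - p(rho) is a - rho times a quadratic that is positive for a <= 1/5, so
    the sign of p at each bound locates rho. *)
Lemma rho_bounds : 106 / 1000 + 710 / 1000 ^+ 2 < rho < 106 / 1000 + 711 / 1000 ^+ 2.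
Proof.
set l := _ + 710 / _; set h := _ + 711 / _.
have quad (a : R) : a <= 1 / 5 ->
    0 < rho ^+ 2 + rho * a + a ^+ 2 - 6 * rho - 6 * a + 10.
  move=> a5; have := sqr_ge0 (rho + (a - 6) / 2); have := sqr_ge0 a; lra.
have fact (a : R) : (a - rho) * (rho ^+ 2 + rho * a + a ^+ 2 - 6 * rho - 6 * a + 10)
   = a ^+ 3 - 6 * a ^+ 2 + 10 * a - 1.
  rewrite -[RHS]subr0 -rho_root; ring.
apply/andP; split; rewrite -subr_gt0.
  rewrite -oppr_lt0 opprB -(pmulr_llt0 _ (quad l _)) ?fact /l; lra.
rewrite -(pmulr_lgt0 _ (quad h _)) ?fact /h.
all: lra.
Qed.

Definition ev (t : Z3) : R :=
  let: (a, b, c) := t in ZtoR a + ZtoR b * rho + ZtoR c * rho ^+ 2.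

Lemma evE a b c : ev (a, b, c) = ZtoR a + ZtoR b * rho + ZtoR c * rho ^+ 2.
Proof. by []. Qed.

Lemma ev_const k : ev (const3 k) = ZtoR k.
Proof. rewrite evE !ZtoRE; ring. Qed.

Lemma rho_cubed : rho ^+ 3 = 6 * rho ^+ 2 - 10 * rho + 1.
Proof. move: rho_root; lra. Qed.

Lemma ev_add s t : ev (add3 s t) = ev s + ev t.
Proof. case: s t => [[a b] c] [[d e] f]; rewrite !evE !ZtoRD; ring. Qed.

Lemma ev_scale k t : ev (scale3 k t) = ZtoR k * ev t.
Proof. case: t => [[a b] c]; rewrite !evE !ZtoRM; ring. Qed.

Lemma ev_sub s t : ev (sub3 s t) = ev s - ev t.
Proof. by rewrite ev_add ev_scale !ZtoRE mulN1r. Qed.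

Lemma ev_sum s : ev (sum3 s) = \sum_(t <- s) ev t.
Proof.
elim: s => [|t s IHs]; first by rewrite big_nil ev_const ZtoR0.
by rewrite big_cons -IHs -ev_add.
Qed.

Lemma ev_mul_rho t : ev (mul_rho t) = rho * ev t.
Proof.
case: t => [[a b] c]; rewrite !evE !ZtoRE.
ring: rho_cubed.
Qed.

Lemma ev_div_rho t : rho * ev (div_rho t) = ev t.
Proof.
case: t => [[a b] c]; rewrite !evE !ZtoRE.
ring: rho_cubed.
Qed.

Lemma ev_len i : ev (len3 i) = len rho i.
Proof. by case: i => [|[|[|[|[|[|[|[|i]]]]]]]]; rewrite evE !ZtoRE /=; ring. Qed.

Lemma ev_tau i : ev (tau3 i) = tau rho i.
Proof. by case: i => [|[|[|[|[|[|[|[|i]]]]]]]]; rewrite evE !ZtoRE /=; ring. Qed.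

Lemma ev_left i : ev (left3 i) = left_end rho i.
Proof. by rewrite ev_sum big_map; apply: eq_bigr => j _; rewrite ev_len. Qed.

Lemma ev_rscale t : ev (rscale3 t) = rscale rho (ev t).
Proof. rewrite ev_add ev_mul_rho /rscale evE !ZtoRE; ring. Qed.

Lemma ev_lower_bound t : ZtoR (lower_bound t) <= 1000 ^+ 4 * ev t.
Proof.
have /andP[lo hi] := rho_bounds.
have Elo : ZtoR million_rho_lo = 1000 * 106 + 710 by rewrite !ZtoRE; ring.
have Ehi : ZtoR million_rho_hi = 1000 * 106 + 711 by rewrite !ZtoRE; ring.
case: t => [[a b] c]; rewrite /lower_bound.
rewrite !ZtoRD !ZtoRM.
have -> : ZtoR 1000000 = 1000 ^+ 2 by rewrite !ZtoRE; ring.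
have hb : ZtoR b * ZtoR (if Z.leb 0 b then million_rho_lo else million_rho_hi)
          <= ZtoR b * (1000 ^+ 2 * rho).
  case: ifP => [b0|/negbT b0].
    apply: ler_wpM2l; rewrite ?Elo; [by rewrite -ZtoR0 ZtoR_le|lra].
  apply: ler_wnM2l; rewrite ?Ehi; [rewrite -ZtoR0 ZtoR_le; lia|lra].
have hc : ZtoR c * ZtoR (if Z.leb 0 c then Z.mul million_rho_lo million_rho_lo
                         else Z.mul million_rho_hi million_rho_hi)
          <= ZtoR c * (1000 ^+ 2 * rho) ^+ 2.
  case: ifP => [c0|/negbT c0]; rewrite ZtoRM.
    apply: ler_wpM2l; rewrite ?Elo; [by rewrite -ZtoR0 ZtoR_le|nra].
  apply: ler_wnM2l; rewrite ?Ehi; [rewrite -ZtoR0 ZtoR_le; lia|nra].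
rewrite evE; move: hb hc.
set u := ZtoR (if _ then _ else _); set v := ZtoR (if _ then _ else _); lra.
Qed.

Lemma nonneg3P t : nonneg3 t -> 0 <= ev t.
Proof.
rewrite /nonneg3 -ZtoR_le ZtoR0 => h; have := le_trans h (ev_lower_bound t).
by rewrite pmulr_rge0 // exprn_gt0.
Qed.

Lemma pos3P t : pos3 t -> 0 < ev t.
Proof.
rewrite /pos3 -ZtoR_lt ZtoR0 => h; have := lt_le_trans h (ev_lower_bound t).
by rewrite pmulr_rgt0 // exprn_gt0.
Qed.

Definition conj_sqrR (t : Z3) : R := ev (conj_sqr t).

Lemma ev_norm t : ev t * conj_sqrR t = ZtoR (norm3 t).
Proof.
rewrite /conj_sqrR; case: t => [[a b] c]; rewrite !evE !ZtoRE.
ring: rho_cubed.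
Qed.

(* Twice the real part, and the quotient of the imaginary part by that of
   beta, of a + b beta + c beta^2. *)
Definition conj_re2 (t : Z3) : R :=
  let: (a, b, c) := t in
  2 * ZtoR a + ZtoR b * (6 - rho) + ZtoR c * (16 - rho ^+ 2).

Definition conj_im (t : Z3) : R :=
  let: (a, b, c) := t in ZtoR b + ZtoR c * (6 - rho).

(* The square of beta - conj beta is - disc. *)
Definition disc : R := 3 * rho ^+ 2 - 12 * rho + 4.

(** This is 4 |w|^2 = (2 Re w)^2 + (2 Im w)^2, with (2 Im beta)^2 = [disc]; it replaces the use of
    complex numbers. *)
Lemma conj_sqrE t :
  4 * conj_sqrR t = conj_re2 t ^+ 2 + disc * conj_im t ^+ 2.
Proof.
rewrite /conj_sqrR /disc; case: t => [[a b] c].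
rewrite /conj_re2 /conj_im evE !ZtoRE.
ring: rho_cubed.
Qed.

Lemma disc_gt2 : 2 < disc.
Proof. have := rho_bounds; rewrite /disc; have := sqr_ge0 rho; lra. Qed.

Lemma conj_sqr_ge0 t : 0 <= conj_sqrR t.
Proof.
have := conj_sqrE t; have := sqr_ge0 (conj_re2 t); have := sqr_ge0 (conj_im t).
have := disc_gt2; nra.
Qed.

(** The parallelogram law without the term of the sum. *)
Lemma conj_sqr_sub s t :
  conj_sqrR (sub3 s t) <= 2 * conj_sqrR s + 2 * conj_sqrR t.
Proof.
have re_sub : conj_re2 (sub3 s t) = conj_re2 s - conj_re2 t.
  by case: (s) (t) => [[a b] c] [[d e] f]; rewrite /conj_re2 /= !ZtoRE; ring.
have im_sub : conj_im (sub3 s t) = conj_im s - conj_im t.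
  by case: (s) (t) => [[a b] c] [[d e] f]; rewrite /conj_im /= !ZtoRE; ring.
rewrite -(ler_pM2l (_ : 0 < 4 :> R)) // mulrDr !(mulrCA 4 2) !conj_sqrE re_sub im_sub.
have := sqr_ge0 (conj_re2 s + conj_re2 t); have := sqr_ge0 (conj_im s + conj_im t).
have := disc_gt2; nra.
Qed.

Lemma conj_sqr_scale k t : conj_sqrR (scale3 k t) = ZtoR k ^+ 2 * conj_sqrR t.
Proof. by case: t => [[a b] c]; rewrite /conj_sqrR !evE !ZtoRE; ring. Qed.

(** The product of the three roots is 1, hence |1 / beta|^2 = rho: division by rho contracts the
    conjugates. *)
Lemma conj_sqr_div_rho t : conj_sqrR (div_rho t) = rho * conj_sqrR t.
Proof.
rewrite /conj_sqrR; case: t => [[a b] c]; rewrite !evE !ZtoRE.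
ring: rho_cubed.
Qed.

End Evaluation.

(** * The exchange and its renormalization *)

Section Dynamics.
Variables (R : realType) (rho : R).
Hypothesis rho_root : rho ^+ 3 - 6 * rho ^+ 2 + 10 * rho - 1 = 0.

Local Notation ev := (ev rho).
Local Notation E := (E2star rho).
Local Notation left_end := (left_end rho).

Lemma nonneg3_sub s t : nonneg3 (sub3 t s) -> ev s <= ev t.
Proof. by move/(nonneg3P rho_root); rewrite ev_sub subr_ge0. Qed.

Lemma pos3_sub s t : pos3 (sub3 t s) -> ev s < ev t.
Proof. by move/(pos3P rho_root); rewrite ev_sub subr_gt0. Qed.

Lemma len_ge0 i : 0 <= len rho i.
Proof.
have /allP h := all_len_pos; case: (boolP (i \in iota 1 7)) => [/h|].
  by move/(pos3P rho_root)/ltW; rewrite ev_len.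
by case: i => [|[|[|[|[|[|[|[|i]]]]]]]].
Qed.

Lemma left_endS i : (0 < i)%N -> left_end i.+1 = left_end i + len rho i.
Proof. by move=> i0; rewrite /left_end big_nat_recr. Qed.

Lemma left_end_le i j : (i <= j)%N -> left_end i <= left_end j.
Proof.
move=> /subnKC <-; elim: (j - i)%N => [|n IHn]; rewrite ?addn0 // addnS.
apply: le_trans IHn _; case: (i + n)%N => [|k].
  by rewrite /Defs.left_end !big_geq.
by rewrite (left_endS (ltn0Sn k)) // lerDl len_ge0.
Qed.

Lemma mem_Omega i x : (0 < i)%N ->
  (x \in Omega rho i) = (left_end i <= x < left_end i.+1).
Proof. by move=> i0; rewrite in_itv /= left_endS. Qed.

Lemma E2star_Omega i x : (0 < i < 8)%N -> left_end i <= x < left_end i.+1 ->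
  E x = x + tau rho i.
Proof.
move=> /andP[i0 i8] /andP[lx xr]; rewrite /E2star big_mkcond /=.
rewrite (bigD1_seq i) ?mem_index_iota ?i0 ?iota_uniq //=.
rewrite mem_Omega // lx xr /= big1_seq ?addr0 // => j /andP[ji].
rewrite mem_index_iota => /andP[j0 _]; rewrite mem_Omega //.
case: ifP => // /andP[ljx xrj]; move: ji; rewrite neq_ltn => /orP[] /left_end_le.
  by move=> /(lt_le_trans xrj); rewrite ltNge lx.
by move=> /(lt_le_trans xr); rewrite ltNge ljx.
Qed.

Lemma Omega_cover x : 0 <= x < 1 ->
  exists2 i, (0 < i < 8)%N & left_end i <= x < left_end i.+1.
Proof.
move=> /andP[x0]; rewrite -(left_end_total rho).
have: left_end 1 <= x by rewrite /Defs.left_end big_geq.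
elim: {x0} 7%N => [|n IHn] lx xr; first by rewrite ltNge lx in xr.
case: (ltP x (left_end n.+1)) => [/(IHn lx)[i /andP[i0 ilt] hi]|nx].
  by exists i => //; rewrite i0 leqW.
by exists n.+1; rewrite /= ?leqnn ?nx.
Qed.

Lemma all_iota17 (P : pred nat) i : all P (iota 1 7) -> (0 < i < 8)%N -> P i.
Proof. by move=> /allP h i17; apply: h; rewrite mem_iota. Qed.

Lemma left_end8 : left_end 8 = 1.
Proof. exact: left_end_total. Qed.

Lemma E2star_unit x : 0 <= x < 1 -> 0 <= E x < 1.
Proof.
move=> /Omega_cover[i i17 xi]; rewrite (E2star_Omega i17 xi).
have /andP[/(nonneg3P rho_root) l /nonneg3_sub r] := all_iota17 all_images_unit i17.
move: l r; rewrite !ev_add !ev_left ev_tau ev_const ZtoR1; move: xi; lra.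
Qed.

Lemma iter_unit n x : 0 <= x < 1 -> 0 <= iter n E x < 1.
Proof. by move=> xu; elim: n => //= n; apply: E2star_unit. Qed.

Lemma E2star_inj x y : 0 <= x < 1 -> 0 <= y < 1 -> E x = E y -> x = y.
Proof.
move=> /Omega_cover[i i17 xi] /Omega_cover[j j17 yj].
rewrite (E2star_Omega i17 xi) (E2star_Omega j17 yj).
have := all_iota17 (all_iota17 all_disjoint_images i17) j17.
case: eqVneq => [->|_] /=; first by move=> _ /addIr.
case/orP => /nonneg3_sub; rewrite !ev_add !ev_left !ev_tau; move: xi yj; lra.
Qed.

Lemma iter_inj n x y : 0 <= x < 1 -> 0 <= y < 1 ->
  iter n E x = iter n E y -> x = y.
Proof.
move=> xu yu; elim: n => //= n IHn; move/E2star_inj => h.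
by apply: IHn; apply: h; apply: iter_unit.
Qed.

Definition conn (x y : R) : Prop :=
  exists k, iter k E x = y \/ iter k E y = x.

Lemma conn_refl x : conn x x.
Proof. by exists 0%N; left. Qed.

Lemma conn_sym x y : conn x y -> conn y x.
Proof. by case=> k h; exists k; case: h; [right|left]. Qed.

Lemma iter_conn k x : conn x (iter k E x).
Proof. by exists k; left. Qed.

(** Injectivity cancels the smaller number of iterations on both sides. *)
Lemma iter_eq_conn k l x y : 0 <= x < 1 -> 0 <= y < 1 ->
  iter k E x = iter l E y -> conn x y.
Proof.
wlog kl : k l x y / (k <= l)%N => [hw xu yu h|xu yu].
  case/orP: (leq_total k l) => kl; first exact: (hw k l).
  by apply/conn_sym/(hw l k).
rewrite -(subnKC kl) iterD => h; apply: conn_sym; exists (l - k)%N; left.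
by apply/esym/(@iter_inj k); rewrite ?iter_unit.
Qed.

Lemma conn_trans y x z : 0 <= x < 1 -> 0 <= y < 1 -> 0 <= z < 1 ->
  conn x y -> conn y z -> conn x z.
Proof.
move=> xu yu zu [k hk] [l hl]; case: hk hl => [xy|yx] [yz|zy].
- by exists (l + k)%N; left; rewrite iterD xy.
- by apply: (@iter_eq_conn k l) => //; rewrite xy zy.
(* Here x = E^k y and z = E^l y, so E^l x = E^k z. *)
- by rewrite -yx -yz; apply: (@iter_eq_conn l k); rewrite ?iter_unit // -!iterD addnC.
- by exists (k + l)%N; right; rewrite iterD zy.
Qed.

Lemma itinerary3P s t w x n : itinerary3 s t w -> ev s <= x < ev t ->
  (n <= size w)%N -> iter n E x = x + \sum_(j <- take n w) tau rho j.
Proof.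
elim: w s t x n => [|j w IHw] s t x [|n] //=; rewrite ?big_nil ?addr0 //.
move=> /and4P[j17 /nonneg3_sub ls /nonneg3_sub tr] it /andP[sx xt] nw.
rewrite -iterS iterSr (E2star_Omega j17) -?ev_left; last first.
  by rewrite (le_trans ls sx) (lt_le_trans xt tr).
rewrite (IHw _ _ _ _ it) ?ev_add ?ev_tau ?lerD2r ?ltrD2r ?sx //.
by rewrite big_cons addrA.
Qed.

(** * Renormalization and the Vershik map *)

Lemma ev_offset p : ev (offset p) =
  1 - rho + \sum_(j <- take p.2 (sigma p.1)) tau rho j.
Proof.
rewrite ev_add ev_sum big_map; congr (_ + _); first by rewrite evE !ZtoRE; ring.
by apply: eq_bigr => j _; rewrite ev_tau.
Qed.

Lemma rho_gt0 : 0 < rho.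
Proof. by have := rho_bounds rho_root; lra. Qed.

(** The rescaled [Omega i] follows one itinerary, so the translation depends on (i, n) alone. The
    case n = [size (sigma i)], beyond the proper prefixes, is the return to [Omega 7]. *)
Lemma iter_rscale i n y : (0 < i < 8)%N -> left_end i <= y < left_end i.+1 ->
  (n <= size (sigma i))%N -> iter n E (rscale rho y) = rho * y + ev (offset (i, n)).
Proof.
move=> i17 yi ni; have rho0 := rho_gt0.
rewrite (itinerary3P (all_iota17 all_itineraries i17)) //.
  by rewrite ev_offset /rscale /=; ring.
by rewrite !(ev_rscale rho_root) !ev_left /rscale lerD2l ltrD2l ler_pM2l // ltr_pM2l.
Qed.

Lemma rscale_unit y : 0 <= y < 1 -> 0 <= rscale rho y < 1.
Proof. have := rho_bounds rho_root; rewrite /rscale; nra. Qed.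

Lemma rscale_E2star y : 0 <= y < 1 ->
  exists k, rscale rho (E y) = iter k E (rscale rho y).
Proof.
move=> /Omega_cover[i i17 yi]; exists (size (sigma i)).
rewrite (iter_rscale i17 yi) // (E2star_Omega i17 yi) ev_offset /= take_size.
have /eqP := all_iota17 all_returns i17; move/(congr1 ev).
rewrite (ev_mul_rho rho_root) ev_tau ev_sum big_map.
by under eq_bigr do rewrite ev_tau; move=> ->; rewrite /rscale; ring.
Qed.

Lemma rscale_iter k y : 0 <= y < 1 ->
  exists l, rscale rho (iter k E y) = iter l E (rscale rho y).
Proof.
move=> yu; elim: k => [|k [l hl]]; first by exists 0%N.
have [m hm] := rscale_E2star (iter_unit k yu).
by exists (m + l)%N; rewrite /= hm hl iterD.
Qed.

Lemma rscale_conn x y : 0 <= x < 1 -> 0 <= y < 1 -> conn x y ->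
  conn (rscale rho x) (rscale rho y).
Proof.
move=> xu yu [k [<-|<-]].
  by have [l ->] := rscale_iter k xu; apply: iter_conn.
by have [l ->] := rscale_iter k yu; apply/conn_sym/iter_conn.
Qed.

Lemma coversP s n t x : covers s n t -> ev t <= x < 1 ->
  exists2 p, p \in s & ev (piece_left p) <= x < ev (piece_right p).
Proof.
elim: n t => [|n IHn] t /=; case: eqP => [->|_] //;
  try by rewrite ev_const ZtoR1 => _ /andP[/le_lt_trans h /h]; rewrite ltxx.
case hs : [seq p <- s | piece_left p == t] => [//|p s'] hc /andP[tx x1].
have: p \in [seq p <- s | piece_left p == t] by rewrite hs mem_head.
rewrite mem_filter => /andP[/eqP pt pp].
case: (ltP x (ev (piece_right p))) => xr; last by apply: (IHn _ hc); rewrite xr.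
by exists p => //; rewrite pt tx.
Qed.

Lemma mem_pieces i n : ((i, n) \in pieces) = (0 < i < 8)%N && (n < size (sigma i))%N.
Proof.
apply/allpairsPdep/andP => [[j [m [+ + [-> ->]]]]|[i17 nm]].
  by rewrite !mem_iota.
by exists i, n; rewrite !mem_iota.
Qed.

Lemma desubst_exists x : 0 <= x < 1 -> exists q, desubst rho x q.
Proof.
move=> /andP[x0 x1]; have rho0 := rho_gt0.
have [|[i n]] := coversP covers_unit (x := x); first by rewrite ev_const ZtoR0 x0.
rewrite mem_pieces => /andP[i17 nm].
rewrite !(ev_add _ (offset _)) !(ev_mul_rho rho_root) !ev_left /= => lr.
pose y : R := (x - ev (offset (i, n))) / rho.
have xE : x = rho * y + ev (offset (i, n)).
  by rewrite /y; field; rewrite gt_eqF.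
have yi : left_end i <= y < left_end i.+1.
  case/andP: lr; move: (y) xE => z -> l r; apply/andP; split.
    by rewrite -(ler_pM2l rho0); move: l; lra.
  by rewrite -(ltr_pM2l rho0); move: r; lra.
exists ((i, take n (sigma i)), y); split => /=.
- by rewrite /prefixes /= prefix_take size_takel ?nm // ltnW.
- by rewrite mem_Omega //; case/andP: i17.
- by rewrite size_takel ?(iter_rscale i17 yi) ?(ltnW nm).
Qed.

Definition piece_of (x : R) : nat * nat :=
  ((vershik_step rho x).1.1, size (vershik_step rho x).1.2).

(** The choice made by [xget] enters the later arguments only through these four facts. *)
Lemma vershik_stepP x : 0 <= x < 1 ->
  [/\ piece_of x \in pieces, 0 <= (vershik_step rho x).2 < 1,
     conn (rscale rho (vershik_step rho x).2) x
   & x = rho * (vershik_step rho x).2 + ev (offset (piece_of x))].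
Proof.
move=> /desubst_exists xq; rewrite /piece_of.
have: desubst rho x (vershik_step rho x).
  by have [q hq] := xq; rewrite /vershik_step; case: xgetP => [q' _ //|/(_ q)].
case: (vershik_step rho x) => [[i mu] y] [/= /andP[pre sz] yi xE].
have i17 : (0 < i < 8)%N by case: i sz {pre yi xE} => [|[|[|[|[|[|[|[|i]]]]]]]].
have i0 : (0 < i)%N by case/andP: i17.
rewrite mem_Omega // in yi.
split=> //.
- by rewrite mem_pieces i17.
- have [yl yr] := andP yi; apply/andP; split.
    apply: le_trans yl; rewrite -[0](_ : left_end 1 = _) ?left_end_le //.
    by rewrite /Defs.left_end big_geq.
  by apply: lt_le_trans yr _; rewrite -left_end8 left_end_le //; case/andP: i17.
- by rewrite xE; apply: iter_conn.
- by rewrite {1}xE (iter_rscale i17 yi) ?(ltnW sz).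
Qed.

End Dynamics.

(** * Contraction of the conjugates *)

Section Lattice.
Variables (R : realType) (rho : R).
Hypothesis rho_root : rho ^+ 3 - 6 * rho ^+ 2 + 10 * rho - 1 = 0.

Local Notation ev := (ev rho).
Local Notation E := (E2star rho).
Local Notation conj_sqrR := (conj_sqrR rho).

Definition lattice (B x : R) : Prop := exists2 t, ev t = x & conj_sqrR t <= B.

(** Subtracting c costs the factor 2 of [conj_sqr_sub]; dividing by rho then gains the factor
    rho. *)
Lemma lattice_step B C x y c : x = rho * y + ev c -> conj_sqrR c <= C ->
  lattice B x -> lattice (2 * rho * (B + C)) y.
Proof.
move=> xE cC [t tx tB]; have rho0 := rho_gt0 rho_root.
exists (div_rho (sub3 t c)).
  apply: (mulfI (lt0r_neq0 rho0)); rewrite (ev_div_rho rho_root) ev_sub tx xE; ring.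
rewrite (conj_sqr_div_rho rho_root) -mulrA mulrCA ler_pM2l // mulrDr.
by apply: le_trans (conj_sqr_sub rho_root _ _) _; rewrite lerD // ler_pM2l.
Qed.

Section Contraction.
Variables (u : nat -> R) (c : nat -> Z3) (B C K : R).
Hypothesis (uE : forall n, u n = rho * u n.+1 + ev (c n)).
Hypothesis (cC : forall n, conj_sqrR (c n) <= C).
Hypothesis (K0 : 0 <= K) (CK : 2 * rho * (K + C) <= K).
Hypothesis (u0 : lattice B (u 0)).

(** The bound evolves under B |-> 2 rho (B + C), of ratio 2 rho < 1, and [CK] says that this map
    does not raise K. *)
Lemma lattice_contract n : lattice ((2 * rho) ^+ n * B + K) (u n).
Proof.
elim: n => [|n IHn].
  by case: u0 => t ht tB; exists t => //; rewrite mul1r -[conj_sqrR t]addr0 lerD.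
have [t ht tB] := lattice_step (uE n) (cC n) IHn.
exists t => //; apply: le_trans tB _.
rewrite (_ : _ * (_ + _) = (2 * rho) ^+ n.+1 * B + 2 * rho * (K + C)) ?lerD2l //.
by rewrite exprS; ring.
Qed.

(** The transient (2 rho)^n B drops below 1 as soon as 2^n >= B, because 4 rho <= 1. *)
Lemma lattice_eventually : exists N, forall n, (N <= n)%N -> lattice (1 + K) (u n).
Proof.
have rho0 := rho_gt0 rho_root; have rhoB := rho_bounds rho_root.
have B0 : 0 <= B by case: u0 => t _; apply/le_trans/(conj_sqr_ge0 rho_root).
exists (Num.bound B) => n Nn; have [t ht tB] := lattice_contract n.
exists t => //; apply: le_trans tB _; rewrite lerD2r.
have Bn : B <= 2 ^+ n.
  apply: le_trans (ltW (archi_boundP B0)) _.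
  by rewrite -natrX ler_nat (leq_trans Nn) // ltnW // ltn_expl.
apply: (@le_trans _ _ ((2 * rho) ^+ n * 2 ^+ n)).
  by rewrite ler_pM2l // exprn_gt0 // mulr_gt0.
by rewrite -exprMn exprn_ile1 //; lra.
Qed.

End Contraction.

(** The combination of the embeddings in which a and b cancel. *)
Lemma ev_conj_coords a b c :
  2 * (ev (a, b, c) : R) - conj_re2 rho (a, b, c)
    + (6 - 3 * rho) * conj_im rho (a, b, c)
  = (6 * rho ^+ 2 - 24 * rho + 20) * ZtoR R c.
Proof. rewrite evE /conj_re2 /conj_im; ring. Qed.

(** Recovers c from [ev_conj_coords], where the factor of c exceeds 35/2, then b from [conj_im] and
    a from [ev]. The fractions 1/8 and 1/9 bound rho, and 1/80 bounds rho^2. *)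
Lemma coords_bound a b c :
  [/\ 35 * `|ZtoR R c|
        <= 4 * `|ev (a, b, c)| + 2 * `|conj_re2 rho (a, b, c)|
           + 12 * `|conj_im rho (a, b, c)|,
     `|ZtoR R b + 6 * ZtoR R c| <= `|conj_im rho (a, b, c)| + `|ZtoR R c| / 8
   & `|ZtoR R a| <= `|ev (a, b, c)| + `|ZtoR R b| / 9 + `|ZtoR R c| / 80].
Proof.
have [lo hi] := andP (rho_bounds rho_root).
have r2 : 0 < rho ^+ 2 < 1 / 80 by apply/andP; split; nra.
split.
- have := congr1 Num.norm (ev_conj_coords a b c); rewrite normrM.
  rewrite [X in _ = X * _]gtr0_norm; last by lra.
  set v := ev _; set r := conj_re2 _ _; set i := conj_im _ _ => cE.
  have := ler_normD (2 * v - r) ((6 - 3 * rho) * i).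
  have := ler_normB (2 * v) r; rewrite cE !normrM normr_nat.
  rewrite [`|6 - _|]gtr0_norm; last by lra.
  have D35 : 0 <= (6 * rho ^+ 2 - 24 * rho + 20 - 35 / 2) * `|ZtoR R c|.
    by rewrite mulr_ge0 //; clear cE; nra.
  have i0 : 0 <= rho * `|i| by rewrite mulr_ge0 // ltW // rho_gt0.
  clear cE; lra.
- rewrite (_ : _ + _ = conj_im rho (a, b, c) + ZtoR R c * rho).
    apply: le_trans (ler_normD _ _) _; rewrite lerD2l normrM ler_wpM2l //.
    by rewrite gtr0_norm; lra.
  by rewrite /conj_im; ring.
- rewrite (_ : ZtoR R a = ev (a, b, c) - ZtoR R b * rho - ZtoR R c * rho ^+ 2).
    apply: le_trans (ler_normB _ _) _; apply: lerD.
      apply: le_trans (ler_normB _ _) _; rewrite lerD2l normrM ler_wpM2l //.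
      by rewrite gtr0_norm; lra.
    by rewrite normrM ler_wpM2l // gtr0_norm; lra.
  by rewrite evE; ring.
Qed.

Lemma mem_centered n z :
  (z \in centered n) = Z.leb (- Z.of_nat n) z && Z.leb z (Z.of_nat n).
Proof.
apply/mapP/idP => [[k]|zn]; first by rewrite mem_iota; lia.
by exists (Z.to_nat (Z.add z (Z.of_nat n))); rewrite ?mem_iota; lia.
Qed.

Lemma ZtoR_nat n : ZtoR R (Z.of_nat n) = n%:R.
Proof. by rewrite unlock (_ : int_of_Z _ = n) //; lia. Qed.

Lemma small_centered n z : `|ZtoR R z| < n.+1%:R -> z \in centered n.
Proof.
rewrite mem_centered ltr_norml -ZtoR_nat -ZtoRN !ZtoR_lt; lia.
Qed.

(** Z[rho] is discrete in R x C: bounds in both embeddings bound the integer coordinates. *)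
Lemma lattice_finite W B : exists s : seq R,
  forall x, `|x| <= W -> lattice B x -> x \in s.
Proof.
pose M : R := 1 + `|W| + 4 * `|B|.
pose C := centered (Num.bound (9 * M)).
have M0 : 0 <= 9 * M by rewrite /M; have := normr_ge0 W; have := normr_ge0 B; lra.
exists [seq ev (p.1, p.2.1, p.2.2) |
         p <- [seq (a, q) | a <- C, q <- [seq (b, c) | b <- C, c <- C]]].
move=> x xW [[[a b] c] tx tB]; subst x.
have [lo hi] := andP (rho_bounds rho_root).
have d2 := disc_gt2 rho_root; have Q := conj_sqrE rho_root (a, b, c).
have re_sqr : conj_re2 rho (a, b, c) ^+ 2 <= 4 * `|B|.
  have := sqr_ge0 (conj_im rho (a, b, c)); have := ler_norm B; nra.
have im_sqr : conj_im rho (a, b, c) ^+ 2 <= 4 * `|B|.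
  have := sqr_ge0 (conj_re2 rho (a, b, c)); have := ler_norm B; nra.
have sqr_small z : z ^+ 2 <= 4 * `|B| -> `|z| <= M.
  move=> h; rewrite ler_norml /M; have := normr_ge0 W.
  have := sqr_ge0 (z - 1); have := sqr_ge0 (z + 1); lra.
have {re_sqr} reM := sqr_small _ re_sqr.
have {sqr_small im_sqr} imM := sqr_small _ im_sqr.
have evM : `|ev (a, b, c)| <= M.
  by apply: le_trans xW _; rewrite /M; have := ler_norm W; have := normr_ge0 B; lra.
have inC z : `|ZtoR R z| <= 9 * M -> z \in C.
  move=> zM; apply: small_centered; apply: le_lt_trans zM _.
  by apply: lt_trans (archi_boundP M0) _; rewrite ltr_nat.
clear lo hi d2 Q xW tB; have [cM bM aM] := coords_bound a b c.
have b_le := ler_normB (ZtoR R b + 6 * ZtoR R c) (6 * ZtoR R c).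
rewrite addrK normrM normr_nat in b_le.
move: M => M in M0 C reM imM evM inC *.
have [aC bC cC] : [/\ a \in C, b \in C & c \in C].
  by split; apply: inC; clear -M0 reM imM evM cM bM aM b_le; lra.
by apply/mapP; exists (a, (b, c)); rewrite // allpairs_f // allpairs_f.
Qed.

Lemma small_triplesP t : 0 <= ev t < 1 -> conj_sqrR t <= 212 -> t \in small_triples.
Proof.
case: t => [[a b] c] /andP[v0 v1] tB.
rewrite mem_filter /small3; apply/andP; split.
  case: ifP => [/(pos3_sub rho_root)|_]; first by rewrite ev_const ZtoR0 ltNge v0.
  case: ifP => [/(nonneg3_sub rho_root)|_]; first by rewrite ev_const ZtoR1 leNgt v1.
  apply/negP => /(pos3_sub rho_root).
  by rewrite ev_const !ZtoRE ltNge (le_trans tB) //; lra.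
have [lo hi] := andP (rho_bounds rho_root).
(* The constants below come from 4 * 212 = 848 <= 29.2^2 and 848 / 2.75 <= 17.6^2. *)
have disc_lo : 275 / 100 <= disc rho by rewrite /disc; have := sqr_ge0 rho; nra.
have Q := conj_sqrE rho_root (a, b, c).
have sqr_small (z e : R) : 0 <= e -> z ^+ 2 <= e ^+ 2 -> `|z| <= e.
  by move=> e0 h; rewrite ler_norml; clear -e0 h; apply/andP; split; nra.
have re_sqr : conj_re2 rho (a, b, c) ^+ 2 <= (292 / 10) ^+ 2.
  have := sqr_ge0 (conj_im rho (a, b, c)); nra.
have im_sqr : conj_im rho (a, b, c) ^+ 2 <= (176 / 10) ^+ 2.
  have := sqr_ge0 (conj_re2 rho (a, b, c)); nra.
clear Q tB lo hi disc_lo.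
have {re_sqr} reB := sqr_small _ _ (divr_ge0 (ler0n R 292) (ler0n R 10)) re_sqr.
have {sqr_small im_sqr} imB :=
  sqr_small _ _ (divr_ge0 (ler0n R 176) (ler0n R 10)) im_sqr.
have evB : `|ev (a, b, c)| < 1 by rewrite ger0_norm.
have [cB bB aB] := coords_bound a b c; clear v0 v1.
have cC : c \in centered 7 by apply: small_centered; lra.
have bC : Z.add b (Z.mul 6 c) \in centered 18.
  by apply: small_centered; rewrite !ZtoRE (_ : 2 * _ = 6); [lra|ring].
have aC : a \in centered 7.
  (* 60 = 18 + 6 * 7. *)
  have b60 : `|ZtoR R b| <= 60.
    move: bC cC; rewrite !mem_centered ler_norml.
    have e60 : ZtoR R 60 = 60 by rewrite !ZtoRE; ring.
    by rewrite -e60 -ZtoRN !ZtoR_le; lia.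
  by apply: small_centered; lra.
apply/allpairsP; exists (a, (Z.add b (Z.mul 6 c), c)); split=> [//||].
  exact: allpairs_f.
by clear; congr (_, _, _); rewrite /=; lia.
Qed.

End Lattice.

(** * Denominators in Q(rho) *)

Section Field.
Variables (R : realType) (rho : R).
Hypothesis rho_root : rho ^+ 3 - 6 * rho ^+ 2 + 10 * rho - 1 = 0.

Local Notation ev := (ev rho).
Local Notation conj_sqrR := (conj_sqrR rho).

Lemma ZtoR_eq0 k : (ZtoR R k == 0) = (k == Z0).
Proof. by rewrite -ZtoR0 eq_le !ZtoR_le; apply/andP/eqP => [[]|->]; lia. Qed.

(** The homogenized cubic vanishes at (k, c). *)
Lemma rho_irrational k c : ZtoR R k = ZtoR R c * rho -> c = Z0.
Proof.
move=> kE; apply: (@cubic_form_eq0 k); apply/eqP; rewrite -ZtoR_eq0 !ZtoRE kE.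
by apply/eqP; ring: (rho_cubed rho_root).
Qed.

(** A vanishing [conj_im] reads b + 6 c = c rho, so c = 0 by irrationality; then b and a vanish in
    turn. *)
Lemma conj_sqr_eq0 t : conj_sqrR t = 0 -> ev t = 0.
Proof.
case: t => [[a b] c] Q0; have := conj_sqrE rho_root (a, b, c).
rewrite Q0 mulr0 => /esym/eqP; have d2 := disc_gt2 rho_root.
rewrite paddr_eq0 ?sqr_ge0 //; last by rewrite mulr_ge0 ?sqr_ge0 //; lra.
rewrite [disc rho * _ == 0]mulf_eq0 !sqrf_eq0 (gt_eqF (lt_trans _ d2)) //=.
move=> /andP[/eqP + /eqP].
rewrite /conj_re2 /conj_im => re0 im0.
have c0 : c = Z0.
  apply: (@rho_irrational (Z.add b (Z.mul 6 c))); rewrite !ZtoRE.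
  by move: im0; lra.
move: im0; rewrite c0 ZtoR0 mul0r addr0 => b0.
move: re0; rewrite c0 b0 !ZtoRE; lra.
Qed.

Definition mul3 (s t : Z3) : Z3 :=
  let: (a, b, c) := s in
  add3 (scale3 a t)
       (add3 (scale3 b (mul_rho t)) (scale3 c (mul_rho (mul_rho t)))).

Lemma ev_mul s t : ev (mul3 s t) = ev s * ev t.
Proof.
case: s => [[a b] c]; rewrite /mul3 evE !ev_add !ev_scale !(ev_mul_rho rho_root).
ring.
Qed.

(** These fractions form a field containing rho: the inverse of [ev t] is its [conj_sqr] divided by
    its norm. *)
Lemma Qrho_fraction x : Qrho rho x ->
  exists2 k : Z, k != Z0 & exists t, ZtoR R k * x = ev t.
Proof.
pose S : {pred R} :=
  fun x => `[< exists2 k : Z, k != Z0 & exists t, ZtoR R k * x = ev t >].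
move=> /(_ S) xS; suff: x \in S by move/asboolP.
apply: {x} xS; last first.
  apply/asboolP; exists (Zpos xH) => //; exists (mul_rho (const3 1)).
  by rewrite (ev_mul_rho rho_root) ev_const ZtoR1 mulrC.
split.
- apply/asboolP; exists (Zpos xH) => //; exists (const3 1).
  by rewrite ev_const ZtoR1 mulr1.
- move=> x y /asboolP[k k0 [s xs]] /asboolP[l l0 [t yt]]; apply/asboolP.
  exists (Z.mul k l); first by rewrite -ZtoR_eq0 ZtoRM mulf_neq0 ?ZtoR_eq0.
  exists (sub3 (scale3 l s) (scale3 k t)).
  by rewrite ev_sub !ev_scale -xs -yt ZtoRM; ring.
- move=> x y /asboolP[k k0 [s xs]] /asboolP[l l0 [t yt]]; apply/asboolP.
  (* Closure under division includes y = 0, whose inverse is 0 by convention. *)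
  have [->|y0] := eqVneq y 0.
    by exists (Zpos xH) => //; exists (const3 0); rewrite ev_const ZtoR0 invr0 !mulr0.
  have t0 : ev t != 0 by rewrite -yt mulf_neq0 // ZtoR_eq0.
  have Q0 : conj_sqrR t != 0 by apply: contra_neq t0; apply: conj_sqr_eq0.
  exists (Z.mul k (norm3 t)).
    by rewrite -ZtoR_eq0 ZtoRM -(ev_norm rho_root) !mulf_neq0 // ZtoR_eq0.
  exists (scale3 l (mul3 s (conj_sqr t))).
  rewrite ev_scale ev_mul -xs -[ev (conj_sqr t)]/(conj_sqrR t) ZtoRM.
  by rewrite -(ev_norm rho_root) -yt; field.
Qed.

End Field.

(** * Codes and orbits *)

Lemma pigeonhole (T : eqType) (s : seq T) (u : nat -> T) :
  (forall n, u n \in s) -> exists i j, (i < j)%N /\ u i = u j.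
Proof.
move=> us; have: ~~ uniq (mkseq u (size s).+1).
  apply/negP => /uniq_leq_size h; have: (size s < size s)%N.
    by rewrite -{1}[(size s).+1](size_mkseq u) h // => _ /mapP[n _ ->].
  by rewrite ltnn.
move=> /(uniqPn (u 0))[i [j [ij]]]; rewrite size_mkseq => jn.
by rewrite !nth_mkseq // ?(ltn_trans ij) // => uij; exists i, j.
Qed.

Section Main.
Variables (R : realType) (rho : R).
Hypothesis rho_root : rho ^+ 3 - 6 * rho ^+ 2 + 10 * rho - 1 = 0.

Local Notation ev := (ev rho).
Local Notation E := (E2star rho).
Local Notation conj_sqrR := (conj_sqrR rho).
Local Notation conn := (conn rho).
Local Notation V := (fun x => (vershik_step rho x).2).
Local Notation piece := (piece_of rho).

Lemma unit_ivlE x : unit_ivl R x = (0 <= x < 1) :> Prop.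
Proof. by rewrite /unit_ivl /= in_itv. Qed.

Lemma ZrhoP x : Zrho rho x <-> exists t, x = ev t.
Proof.
split=> [[a [b [c ->]]]|[[[a b] c] ->]].
  by exists (Z_of_int a, Z_of_int b, Z_of_int c); rewrite evE unlock !Z_of_intK.
by exists (int_of_Z a), (int_of_Z b), (int_of_Z c); rewrite evE unlock.
Qed.

Lemma iter_Zrho k x : 0 <= x < 1 -> exists t, iter k E x = x + ev t.
Proof.
move=> xu; elim: k => [|k [t ht]].
  by exists (const3 0); rewrite ev_const ZtoR0 addr0.
have [i i17 xi] := Omega_cover rho (iter_unit rho_root k xu).
exists (add3 t (tau3 i)).
by rewrite /= (E2star_Omega rho_root i17 xi) ht ev_add ev_tau addrA.
Qed.

(** All translation lengths lie in Z[rho], so an orbit stays in its layer. *)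
Lemma conn_Zrho x y : 0 <= x < 1 -> 0 <= y < 1 -> conn x y ->
  exists t, y = x + ev t.
Proof.
move=> xu yu [k [<-|<-]]; first exact: iter_Zrho.
have [t ->] := iter_Zrho k yu; exists (sub3 (const3 0) t).
by rewrite ev_sub ev_const ZtoR0; ring.
Qed.

Lemma offset_bounded p : p \in pieces -> conj_sqrR (offset p) <= 776.
Proof.
move=> /(allP all_offsets_bounded)/(nonneg3_sub rho_root) h.
by apply: le_trans h _; rewrite ev_const !ZtoRE; lra.
Qed.

(** * Iterates of the Vershik map and periodic codes *)

Lemma iterV_unit n x : 0 <= x < 1 -> 0 <= iter n V x < 1.
Proof.
by move=> xu; elim: n => //= n /(vershik_stepP rho_root)[].
Qed.

Lemma iterVE n x : 0 <= x < 1 ->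
  iter n V x = rho * iter n.+1 V x + ev (offset (piece (iter n V x))).
Proof. by move=> /(iterV_unit n)/(vershik_stepP rho_root)[]. Qed.

Lemma iterV_offset n x : 0 <= x < 1 ->
  conj_sqrR (offset (piece (iter n V x))) <= 776.
Proof.
by move=> /(iterV_unit n)/(vershik_stepP rho_root)[+ _ _ _] => /offset_bounded.
Qed.

(** Each point shares an orbit with the rescaling of its image under the Vershik map, and rescaling
    preserves orbits. *)
Lemma conn_of_V x y : 0 <= x < 1 -> 0 <= y < 1 -> conn (V x) (V y) -> conn x y.
Proof.
move=> xu yu; have [_ x'u x'x _] := vershik_stepP rho_root xu.
have [_ y'u y'y _] := vershik_stepP rho_root yu.
move=> /(rscale_conn rho_root x'u y'u) h.
have rx := rscale_unit rho_root x'u; have ry := rscale_unit rho_root y'u.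
apply: (conn_trans rho_root xu rx yu (conn_sym x'x)).
exact: (conn_trans rho_root rx ry yu h y'y).
Qed.

Lemma conn_of_iterV n x y : 0 <= x < 1 -> 0 <= y < 1 ->
  conn (iter n V x) (iter n V y) -> conn x y.
Proof.
move=> xu yu; elim: n => //= n IHn h; apply/IHn/conn_of_V => //; exact: iterV_unit.
Qed.

(** Multiplied by a denominator k, the Vershik itinerary of x lies in a finite part of Z[rho]; a
    repeated point repeats the code after it. *)
Lemma Qrho_eventually_periodic x : 0 <= x < 1 -> Qrho rho x ->
  eventually_periodic (vershik_code rho x).
Proof.
move=> xu /(Qrho_fraction rho_root)[k k0 [t xt]].
have kR0 : ZtoR R k != 0 by rewrite ZtoR_eq0.
pose u n := ZtoR R k * iter n V x.
pose c n := scale3 k (offset (piece (iter n V x))).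
pose K := ZtoR R k ^+ 2 * 776.
have [lo hi] := andP (rho_bounds rho_root).
have K0 : 0 <= K by rewrite mulr_ge0 // sqr_ge0.
have uE n : u n = rho * u n.+1 + ev (c n).
  by rewrite /u {1}(iterVE n xu) ev_scale; ring.
have cK n : conj_sqrR (c n) <= K.
  by rewrite conj_sqr_scale ler_wpM2l ?sqr_ge0 ?iterV_offset.
have KK : 2 * rho * (K + K) <= K by clear -hi K0; nra.
have u0 : lattice rho (conj_sqrR t) (u 0%N) by exists t.
have [s hs] := lattice_finite rho_root `|ZtoR R k| (conj_sqrR t + K).
have us n : u n \in s.
  apply: hs.
    rewrite normrM ler_piMr //; have /andP[l r] := iterV_unit n xu.
    by rewrite ger0_norm // ltW.
  (* Since (2 rho)^n <= 1, one bound serves every n. *)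
  have [t' ht' tB] := lattice_contract rho_root uE cK K0 KK u0 n.
  exists t' => //; apply: le_trans tB _; rewrite lerD2r ler_piMl ?conj_sqr_ge0 //.
  by rewrite exprn_ile1 //; lra.
have [i [j [ij /(mulfI kR0) Vij]]] := pigeonhole us.
exists i, (j - i)%N; split; first by rewrite subn_gt0.
move=> n ni; rewrite /vershik_code; congr (vershik_step _ _).1.
rewrite -(subnK ni) -addnA subnKC ?(ltnW ij) // !iterD.
by congr iter; rewrite -/(iter _ _ _) Vij.
Qed.

(** Otherwise |d| 2^k <= (2 r)^k <= 1 for all k, against the Archimedean property. *)
Lemma eq0_of_le_expr (r d : R) : 0 <= r -> 2 * r <= 1 ->
  (forall k, `|d| <= r ^+ k) -> d = 0.
Proof.
move=> r0 r2 h; apply/eqP; case: eqVneq => // d0.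
have dp : 0 < `|d| by rewrite normr_gt0.
have := archi_boundP (ltW (eqbRL (invr_gt0 _) dp)); set k := Num.bound _ => dk.
have : `|d| * 2 ^+ k <= 1.
  apply: (@le_trans _ _ (r ^+ k * 2 ^+ k)); first by rewrite ler_wpM2r ?exprn_ge0.
  by rewrite -exprMn exprn_ile1 ?mulr_ge0 // mulrC.
rewrite leNgt => /negP[]; rewrite -ltr_pdivrMl // mulr1.
apply: lt_trans dk _; rewrite -natrX ltr_nat; exact: ltn_expl.
Qed.

(** While two codes agree, the difference of the points is divided by rho at each step yet stays
    bounded; so the points themselves recur. *)
Lemma eventually_periodic_Qrho x : 0 <= x < 1 ->
  eventually_periodic (vershik_code rho x) -> Qrho rho x.
Proof.
move=> xu [N [p [p0 per]]].
have [lo hi] := andP (rho_bounds rho_root).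
have rho0 : 0 <= rho by rewrite ltW // rho_gt0.
have dE k : iter N V x - iter (N + p) V x
    = rho ^+ k * (iter (N + k) V x - iter (N + k + p) V x).
  elim: k => [|k ->]; first by rewrite addn0 mul1r.
  rewrite (iterVE (N + k) xu) (iterVE (N + k + p) xu).
  have -> : piece (iter (N + k + p) V x) = piece (iter (N + k) V x).
    by have := per (N + k)%N (leq_addr _ _); rewrite /piece_of /vershik_code => ->.
  by rewrite addnS exprSr; ring.
have yE : iter (N + p) V x = iter N V x.
  apply/esym/eqP; rewrite -subr_eq0; apply/eqP/(@eq0_of_le_expr rho); [lra|lra|].
  move=> k; rewrite (dE k) normrM ger0_norm ?exprn_ge0 ?ler_piMr ?exprn_ge0 //.
  have /andP[a0 a1] := iterV_unit (N + k) xu.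
  have /andP[b0 b1] := iterV_unit (N + k + p) xu.
  by rewrite ler_norml; clear -a0 a1 b0 b1; lra.
move=> S [S1 SB Sdiv] Srho.
have S0 : 0 \in S by rewrite -(subrr 1) SB.
have SD a b : a \in S -> b \in S -> a + b \in S.
  by move=> aS bS; rewrite -[b]opprK -[- b]sub0r !SB.
have SM a b : a \in S -> b \in S -> a * b \in S.
  by move=> aS bS; rewrite -[b]invrK -[b^-1]mul1r !Sdiv.
have Snat n : n%:R \in S by elim: n => // n IHn; rewrite -addn1 natrD SD.
have SZ k : ZtoR R k \in S.
  rewrite unlock; case: (int_of_Z k) => n; first exact: Snat.
  by rewrite NegzE mulrNz -[- _]sub0r SB // Snat.
have Sev t : ev t \in S by case: t => [[a b] c]; rewrite evE !SD ?SM.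
have Sexp n : rho ^+ n \in S by elim: n => // n IHn; rewrite exprS SM.
have unfold n k : exists2 a, a \in S & iter n V x = a + rho ^+ k * iter (n + k) V x.
  elim: k => [|k [a aS ->]]; first by exists 0; rewrite ?add0r ?mul1r ?addn0.
  exists (a + rho ^+ k * ev (offset (piece (iter (n + k) V x)))).
    by rewrite SD ?SM.
  by rewrite {1}(iterVE (n + k) xu) addnS exprSr; ring.
(* With y = V^N x this gives y = a + rho^p y and x = b + rho^N y, solved for y and then x. *)
have [a aS aE] := unfold N p; have [b bS /= ->] := unfold 0%N N.
rewrite SD // SM // add0n; have r1 : 1 - rho ^+ p != 0.
  by rewrite subr_eq0 eq_sym lt_eqF // exprn_ilt1 -?lt0n //; lra.
rewrite (_ : iter N V x = a / (1 - rho ^+ p)) ?Sdiv ?SB //.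
by apply: (canRL (mulfK r1)); rewrite mulrBr mulr1 {1}aE yE; ring.
Qed.

(** * Orbits of the discontinuities *)

Lemma discontinuity_unit d : d \in discontinuities -> 0 <= ev d < 1.
Proof.
move=> /mapP[i]; rewrite mem_iota => /andP[i2 i8] ->; rewrite ev_left.
apply/andP; split.
  by rewrite -[0](_ : left_end rho 1 = _) ?left_end_le ?(ltnW i2) // /left_end big_geq.
apply: (@le_lt_trans _ _ (left_end rho 7)); first by rewrite left_end_le.
by rewrite -(left_end8 rho) (@left_endS _ rho 7) // ltrDl rho_gt0.
Qed.

Lemma step3_conn t : 0 <= ev t < 1 ->
  0 <= ev (step3 t) < 1 /\ conn (ev t) (ev (step3 t)).
Proof.
rewrite /step3; set i := (find _ _).+1 => tu.
case: ifP => [|_]; last by split=> //; apply: conn_refl.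
rewrite /in3 => /andP[/(nonneg3_sub rho_root) + /(pos3_sub rho_root)].
rewrite !ev_left ev_add ev_tau => il ir.
(* A failed [find] returns 7, thus i = 8, whose left end is 1. *)
have i17 : (0 < i < 8)%N.
  apply/andP; split=> //; rewrite ltnNge; apply/negP => i8; have /andP[_] := tu.
  by rewrite ltNge -(left_end8 rho) (le_trans _ il) // left_end_le.
have it : left_end rho i <= ev t < left_end rho i.+1 by rewrite il.
rewrite -(E2star_Omega rho_root i17 it); split; first exact: E2star_unit.
exact: (iter_conn rho 1).
Qed.

Lemma iter_step3_conn n t : 0 <= ev t < 1 ->
  0 <= ev (iter n step3 t) < 1 /\ conn (ev t) (ev (iter n step3 t)).
Proof.
move=> tu; elim: n => [|n [nu nc]]; first by split=> //; apply: conn_refl.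
have [su sc] := step3_conn nu; split=> //; exact: (conn_trans rho_root tu nu).
Qed.

Definition near_discontinuity (y : R) : Prop :=
  exists2 d, d \in discontinuities & conn (ev d) y.

Lemma reaches_discontinuityP n t : 0 <= ev t < 1 ->
  reaches_discontinuity n t -> near_discontinuity (ev t).
Proof.
elim: n t => [|n IHn] t tu /=; case: ifP => [td _|_] //;
  try by exists t => //; apply: conn_refl.
have [su sc] := step3_conn tu => /(IHn _ su)[d dd dc]; exists d => //.
exact: (conn_trans rho_root (discontinuity_unit dd) su tu dc (conn_sym sc)).
Qed.

Lemma connected3P m n t : 0 <= ev t < 1 ->
  connected3 (forward_orbits m) n t -> near_discontinuity (ev t).
Proof.
move=> tu; rewrite /connected3; case: ifP => [/flattenP[s /mapP[d dd ->]] + _|_].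
  move=> /trajectP[k _ ->]; exists d => //.
  by have [] := iter_step3_conn k (discontinuity_unit dd).
exact: reaches_discontinuityP.
Qed.

(** Rescaling sends the orbit of d into that of [rscale d], which the computation joins to some
    discontinuity d'. *)
Lemma near_of_V y : 0 <= y < 1 -> near_discontinuity (V y) -> near_discontinuity y.
Proof.
move=> yu [d dd dc]; have [_ y'u y'y _] := vershik_stepP rho_root yu.
have du := discontinuity_unit dd; have rdu := rscale_unit rho_root du.
have ry'u := rscale_unit rho_root y'u.
have [|d' d'd d'c] := @connected3P 30 30 (rscale3 d) _ (allP all_rscale_connected _ dd).
  by rewrite (ev_rscale rho_root).
rewrite (ev_rscale rho_root) in d'c.
have d'u := discontinuity_unit d'd.
exists d' => //; apply: (conn_trans rho_root d'u ry'u yu _ y'y).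
exact: (conn_trans rho_root d'u rdu ry'u d'c (rscale_conn rho_root du y'u dc)).
Qed.

(** The contraction brings the point into [small_triples], where the claim is computed; [near_of_V]
    then lifts it back step by step. *)
Lemma Zrho_near_discontinuity t : 0 <= ev t < 1 -> near_discontinuity (ev t).
Proof.
move=> tu; have [lo hi] := andP (rho_bounds rho_root).
have K0 : 0 <= 211 :> R by [].
have CK : 2 * rho * (211 + 776) <= 211 by clear -hi; lra.
have u0 : lattice rho (conj_sqrR t) (iter 0 V (ev t)) by exists t.
have [N hN] := lattice_eventually rho_root (fun n => iterVE n tu)
  (fun n => iterV_offset n tu) K0 CK u0.
have [t' t'E t'B] := hN N (leqnn N).
have Nu := iterV_unit N tu.
have : near_discontinuity (iter N V (ev t)).
  rewrite -t'E in Nu *; apply: (connected3P Nu); apply: (allP all_small_connected).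
  by apply: (small_triplesP rho_root Nu); apply: le_trans t'B _; rewrite -nat1r.
elim: N {hN t'E Nu} => // N IHN h; apply: IHN; apply: near_of_V => //.
exact: iterV_unit.
Qed.

Lemma Zrho_unit_orbits :
  Zrho rho `&` unit_ivl R =
  \bigcup_(i in [set i : nat | (2 <= i <= 7)%N]) E2orbit rho (left_end rho i).
Proof.
apply/seteqP; split=> y.
  move=> [/ZrhoP[t ->]]; rewrite unit_ivlE => tu.
  have [d /mapP[i]] := Zrho_near_discontinuity tu.
  rewrite mem_iota => i27 -> hc; exists i => //.
  by split; rewrite ?unit_ivlE // -ev_left.
move=> [i i27 [yu yc]]; split=> //; apply/ZrhoP.
have du : 0 <= ev (left3 i) < 1.
  by apply: discontinuity_unit; apply: map_f; rewrite mem_iota.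
rewrite unit_ivlE in yu; rewrite -ev_left in yc; have [t ->] := conn_Zrho du yu yc.
by exists (add3 (left3 i) t); rewrite ev_add.
Qed.

(** * Uniform bound on the orbits in a layer *)

Lemma differences_finite : exists s : seq R,
  forall x y, 0 <= x < 1 -> 0 <= y < 1 -> (exists t, x = y + ev t) ->
  exists N, forall n, (N <= n)%N -> iter n V x - iter n V y \in s.
Proof.
have [lo hi] := andP (rho_bounds rho_root).
(* The set is fixed before x and y, so it serves all layers. Differences of two offsets are bounded
   by 2 * 776 + 2 * 776. *)
have [s hs] := lattice_finite rho_root 1 (1 + 4 * 776).
exists s => x y xu yu [t xE].
pose c n := sub3 (offset (piece (iter n V x))) (offset (piece (iter n V y))).
have uE n : iter n V x - iter n V y = rho * (iter n.+1 V x - iter n.+1 V y) + ev (c n).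
  by rewrite {1}(iterVE n xu) {1}(iterVE n yu) ev_sub; ring.
have cC n : conj_sqrR (c n) <= 4 * 776.
  apply: le_trans (conj_sqr_sub rho_root _ _) _.
  by have := iterV_offset n xu; have := iterV_offset n yu; clear -hi; lra.
have K0 : 0 <= 4 * 776 :> R by rewrite mulr_ge0.
have CK : 2 * rho * (4 * 776 + 4 * 776) <= 4 * 776 by clear -hi; lra.
have u0 : lattice rho (conj_sqrR t) (iter 0 V x - iter 0 V y).
  by exists t => //=; rewrite xE; ring.
have [N hN] := lattice_eventually rho_root uE cC K0 CK u0.
exists N => n Nn; apply: hs; last exact: hN.
have /andP[a0 a1] := iterV_unit n xu; have /andP[b0 b1] := iterV_unit n yu.
by rewrite ler_norml; clear -a0 a1 b0 b1; lra.
Qed.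

Definition layer (xi x : R) : Prop := 0 <= x < 1 /\ exists t, x = xi + ev t.

Lemma layer_diff xi x y : layer xi x -> layer xi y -> exists t, x = y + ev t.
Proof.
by move=> [_ [t ->]] [_ [t' ->]]; exists (sub3 t t'); rewrite ev_sub; ring.
Qed.

Definition inequivalent (s : seq R) : bool :=
  pairwise (fun x y => ~~ `[< conn x y >]) s.

(* Inequivalent points stay distinct under iterates of V, which eventually
   bring their differences into the fixed finite set. *)
Lemma inequivalent_size : exists M, forall xi (s : seq R),
  (forall x, x \in s -> layer xi x) -> inequivalent s -> (size s <= M)%N.
Proof.
have [D hD] := differences_finite; exists (size D) => xi [//|y s] layers.
set s' := y :: s in layers * => ineq.
have ly : layer xi y by apply: layers; rewrite mem_head.
have [N hN] : exists N, forall x, x \in s' -> iter N V x - iter N V y \in D.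
  (* Membership for all later n lets the induction take the maximum of the two times. *)
  suff [N hN] : exists N, forall x, x \in s' -> forall n, (N <= n)%N ->
      iter n V x - iter n V y \in D by exists N => x /hN; apply.
  elim: s' {ineq} layers => [|x r IHr] hr; first by exists 0%N.
  have lx : layer xi x by apply: hr; rewrite mem_head.
  have [|N1 h1] := IHr; first by move=> z zr; apply: hr; rewrite inE zr orbT.
  have [N2 h2] := hD _ _ lx.1 ly.1 (layer_diff lx ly).
  exists (maxn N1 N2) => z; rewrite inE => /orP[/eqP ->|zr] n;
    rewrite geq_max => /andP[n1 n2].
    exact: h2.
  exact: h1.
rewrite -(size_map (fun x => iter N V x - iter N V y) s').
apply: uniq_leq_size; last first.
  by move=> _ /mapP[x xs ->]; apply: hN.
rewrite uniq_pairwise pairwise_map.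
apply: (sub_in_pairwise (P := mem s')) ineq; last exact/allP.
move=> x z xs zs /asboolPn xz /=; apply/eqP => /addIr xzE; apply: xz.
apply: (conn_of_iterV (n := N) (layers _ xs).1 (layers _ zs).1).
by rewrite xzE; apply: conn_refl.
Qed.

(** A longest list of inequivalent points meets every orbit of the layer, since a missed point could
    be added to it. *)
Lemma layer_orbits : exists M, forall xi, exists s : seq R,
  [/\ (size s <= M)%N, forall x, x \in s -> layer xi x
    & forall x, layer xi x -> exists2 y, y \in s & conn y x].
Proof.
have [M hM] := inequivalent_size; exists M => xi.
pose P n := `[< exists s : seq R,
  [/\ forall x, x \in s -> layer xi x, inequivalent s & size s = n] >].
have P0 : exists n, P n by exists 0%N; apply/asboolP; exists [::].
have PM n : P n -> (n <= M)%N by move=> /asboolP[s [sl si <-]]; exact: (hM _ _ sl si).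
case: (ex_maxnP P0 PM) => n /asboolP[s [sl si sn]] nmax.
exists s; split=> // [|x lx]; first exact: (hM _ _ sl si).
apply: contrapT => no; suff /nmax : P n.+1 by rewrite ltnn.
apply/asboolP; exists (x :: s); split; last by rewrite /= sn.
  by move=> y; rewrite inE => /orP[/eqP ->|/sl].
rewrite /inequivalent pairwise_cons [pairwise _ _]si andbT.
apply/allP => y ys; apply/asboolPn => xy; apply: no; exists y => //.
exact: conn_sym.
Qed.

Lemma layer_unit_orbits : exists M : nat, (0 < M)%N /\
  forall xi : R, exists s : seq R,
    [/\ (size s <= M)%N,
        (forall x, x \in s -> unit_ivl R x)
      & [set xi + m | m in Zrho rho] `&` unit_ivl R =
          \bigcup_(x in [set` s]) E2orbit rho x].
Proof.
(* The successor ensures a positive bound. *)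
have [M hM] := layer_orbits; exists M.+1; split=> // xi.
have [s [sM sl sc]] := hM xi; exists s; split=> [||]; first exact: leqW.
  by move=> x /sl[]; rewrite unit_ivlE.
apply/seteqP; split=> y /=.
  move=> [[m /ZrhoP[t ->] <-]]; rewrite unit_ivlE => yu.
  have [|x xs xy] := sc (xi + ev t); first by split=> //; exists t.
  by exists x => //; split; rewrite ?unit_ivlE.
move=> [x /= xs [yu xy]]; split=> //; rewrite unit_ivlE in yu.
have [xu [t xE]] := sl x xs; have [t' ->] := conn_Zrho xu yu xy.
exists (ev (add3 t t')); first by apply/ZrhoP; exists (add3 t t').
by rewrite ev_add xE addrA.
Qed.

End Main.

Theorem proposition13 (R : realType) (rho : R)
    (hrho : rho ^+ 3 - 6 * rho ^+ 2 + 10 * rho - 1 = 0) :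
  [/\ (forall x : R, unit_ivl R x ->
        ((Qrho rho `&` unit_ivl R) x <->
         eventually_periodic (vershik_code rho x))),
      Zrho rho `&` unit_ivl R =
        \bigcup_(i in [set i : nat | (2 <= i <= 7)%N]) E2orbit rho (left_end rho i)
    & exists M : nat, (0 < M)%N /\
        forall xi : R, Qrho rho xi ->
          exists s : seq R,
            [/\ (size s <= M)%N,
                (forall x, x \in s -> unit_ivl R x)
              & [set xi + m | m in Zrho rho] `&` unit_ivl R =
                \bigcup_(x in [set` s]) E2orbit rho x]].
Proof.
split=> [x xu||].
- rewrite unit_ivlE in xu; split=> [[xQ _]|xp]; first exact: Qrho_eventually_periodic.
  by split; [exact: eventually_periodic_Qrho|rewrite unit_ivlE].
- exact: Zrho_unit_orbits.
- by have [M [M0 hM]] := layer_unit_orbits hrho; exists M; split=> // xi _.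
Qed.
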